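(* Let $H$ be a real Hilbert space, let $\mathcal{D}$ be a dictionary in $H$, and let $\tau=\{t_k\}_{k=1}^\infty$, $t_k\in[0,1]$, be a nonincreasing weakness sequence. Let $m\ge 1$ be an integer and let $0\le \alpha\le \frac{t_m}{t_m+2}$. Then for every $f\in H$ and every realization of the Weak Greedy Algorithm WGA($\mathcal{D},\tau$) applied to $f$, with approximants $G^\tau_m(f,\mathcal{D})$, one has $$\|f-G^\tau_m(f,\mathcal{D})\|\le \left(1+\sum_{k=1}^m t_k^2\right)^{-\alpha/2}\|f\|^{1-\alpha}\,\|f\|_{A_1(\mathcal{D})}^{\alpha}.$$
   Context: $H$ is a real Hilbert space with inner product $\langle\cdot,\cdot\rangle$ and norm $\|x\|=\langle x,x\rangle^{1/2}$. A dictionary is a set $\mathcal{D}\subset H$ such that $\|g\|=1$ for every $g\in\mathcal{D}$ and the closed linear span of $\mathcal{D}$ is $H$. $A_1(\mathcal{D})$ is the closure in $H$ of the convex hull of $\mathcal{D}^{\pm}=\{\pm g: g\in\mathcal{D}\}$, and $\|f\|_{A_1(\mathcal{D})}=\inf\{M>0: f/M\in A_1(\mathcal{D})\}$ (with $\inf\emptyset=+\infty$). Conventions: $x^0=1$ for all $x\in[0,+\infty]$, and $(+\infty)^\alpha=+\infty$ for $\alpha>0$. Weak Greedy Algorithm WGA($\mathcal{D},\tau$): given $f\in H$, put $f_0=f$. For each $m\ge1$: (i) $\varphi_m\in\mathcal{D}$ is any element satisfying $|\langle f_{m-1},\varphi_m\rangle|\ge t_m\sup_{g\in\mathcal{D}}|\langle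 f_{m-1},g\rangle|$ (if $t_m=1$ it is assumed that such a maximizer exists); (ii) $f_m=f_{m-1}-\langle f_{m-1},\varphi_m\rangle\varphi_m$; (iii) $G^\tau_m(f,\mathcal{D})=\sum_{j=1}^m\langle f_{j-1},\varphi_j\rangle\varphi_j$. Thus $f_m=f-G^\tau_m(f,\mathcal{D})$. A realization is any sequence produced by admissible choices of the $\varphi_m$. *)

(* Defs.v *)
(* A real Hilbert space is a complete normed module [H] over a [realType]
   together with an inner product [dot : {dot H for idfun}] (a symmetric,
   positive definite bilinear form) that induces the norm of [H]; the last
   condition is a hypothesis of the theorem. *)
From HB Require Import structures.
From mathcomp Require Export all_boot all_order all_algebra.
From mathcomp Require Export all_classical all_reals all_analysis.

Set Implicit Arguments.
Unset Strict Implicit.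
Unset Printing Implicit Defensive.

Import Order.TTheory GRing.Theory Num.Theory.
Import numFieldNormedType.Exports.

Local Open Scope classical_set_scope.
Local Open Scope ring_scope.

Section Dictionary.
Context {R : realType} {H : completeNormedModType R}.
Implicit Types (D : set H) (f : H).

Definition linear_span D : set H :=
  [set x | exists (n : nat) (c : 'I_n -> R) (g : 'I_n -> H),
      (forall i, D (g i)) /\ x = \sum_(i < n) c i *: g i].

Definition convex_hull (A : set H) : set H := smallest (@convex_set R H) A.

Definition is_dictionary D : Prop :=
  (forall g, D g -> `|g| = 1) /\ closure (linear_span D) = setT.

Definition symmetrization D : set H := D `|` (-%R @` D).

Definition A1 D : set H := closure (convex_hull (symmetrization D)).

(* The infimum is taken in [\bar R], so that it is [+oo] when no M works. *)
Definition A1norm D f : \bar R :=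
  ereal_inf [set M%:E | M in [set M : R | 0 < M /\ A1 D (M^-1 *: f)]].

End Dictionary.

Section WeakGreedyAlgorithm.
Context {R : realType} {H : completeNormedModType R} (dot : {dot H for idfun}).
Implicit Types (D : set H) (f : H) (phi : nat -> H) (t : nat -> R).

(* The sequences [t] and [phi] are indexed from 1: their values at 0 are never
   used. *)
Fixpoint wga_residual f phi (n : nat) : H :=
  if n is k.+1 then
    let r := wga_residual f phi k in r - dot r (phi k.+1) *: phi k.+1
  else f.

Definition wga_approx f phi (n : nat) : H :=
  \sum_(1 <= j < n.+1) dot (wga_residual f phi j.-1) (phi j) *: phi j.

(* The supremum is the real-valued [sup]; its argument is bounded by the
   Cauchy-Schwarz inequality, and is nonempty as soon as [phi n] is in [D]. *)
Definition wga_realization D t f phi : Prop :=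
  forall n : nat, (1 <= n)%N ->
    D (phi n) /\
    t n * sup [set `|dot (wga_residual f phi n.-1) g| | g in D]
      <= `|dot (wga_residual f phi n.-1) (phi n)|.

End WeakGreedyAlgorithm.

(* Main.v *)
(* Let f_n be the residuals, y_n = |<f_n, phi_(n+1)>|, and let M > 0 be such that
   f / M lies in A_1(D). Then b_n = M + y_0 + ... + y_(n-1) bounds the A_1-norm
   of f_n, so |f_n|^2 <= b_n sup_g |<f_n, g>| and hence
   t_(n+1) |f_n|^2 <= b_n y_n. Together with |f_(n+1)|^2 = |f_n|^2 - y_n^2 this
   gives two estimates by induction: (1 + sum_(k <= n) t_k^2) |f_n|^2 <= b_n^2,
   and |f_n|^(1 - alpha) b_n^alpha is nonincreasing for n <= m. Eliminating b_m
   yields the bound with M in place of the A_1-norm. *)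
Require Import Defs.
From mathcomp Require Import ring lra.

Set Implicit Arguments.
Unset Strict Implicit.
Unset Printing Implicit Defensive.

Import Order.TTheory GRing.Theory Num.Theory.
Import numFieldNormedType.Exports.

Local Open Scope classical_set_scope.
Local Open Scope ring_scope.

(** * Inner product: Cauchy-Schwarz, continuity, bounds over [A1 D] *)

Section RealInnerProduct.
Context {R : realType} {H : completeNormedModType R} {dot : {dot H for idfun}}.
Hypothesis dot_norm : forall x : H, `|x| = Num.sqrt (dot x x).

Lemma dotC x y : dot x y = dot y x.
Proof. by rewrite hermC expr0 mul1r. Qed.

Lemma dot_ge0 x : 0 <= dot x x.
Proof.
have [->|x0] := eqVneq x 0; first by rewrite linear0l.
by apply/ltW; exact: neq0_dnorm_gt0.
Qed.

Lemma sqr_norm_dot x : `|x| ^+ 2 = dot x x.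
Proof. by rewrite dot_norm sqr_sqrtr ?dot_ge0. Qed.

Lemma dotDr h x y : dot h (x + y) = dot h x + dot h y.
Proof. exact: linearDr. Qed.

Lemma dotZr h a x : dot h (a *: x) = a * dot h x.
Proof. exact: linearZr. Qed.

Lemma dotBr h x y : dot h (x - y) = dot h x - dot h y.
Proof. exact: linearBr. Qed.

Lemma sqr_normD x y : `|x + y| ^+ 2 = `|x| ^+ 2 + 2 * dot x y + `|y| ^+ 2.
Proof.
by rewrite !sqr_norm_dot dotDr dotC [in X in _ + X]dotC !dotDr (dotC y x); ring.
Qed.

(* The triangle inequality is part of the normed structure, so Cauchy-Schwarz is
   obtained by squaring it. *)
Lemma dot_CauchySchwarz x y : `|dot x y| <= `|x| * `|y|.
Proof.
have CS z : dot x z <= `|x| * `|z|.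
  have := lerXn2r 2 _ _ (ler_normD x z).
  by rewrite !nnegrE addr_ge0// sqr_normD => /(_ (normr_ge0 _) isT); nra.
rewrite ler_norml CS andbT.
by have := CS (- y); rewrite normrN -scaleN1r dotZr; lra.
Qed.

Lemma sqr_norm_residual (x g : H) : `|g| = 1 ->
  `|x - dot x g *: g| ^+ 2 = `|x| ^+ 2 - `|dot x g| ^+ 2.
Proof.
move=> g1; rewrite -scaleNr sqr_normD dotZr normrZ g1 normrN mulr1.
by rewrite real_normK ?num_real//; ring.
Qed.

Lemma dot_continuous h : continuous (dot h).
Proof.
move=> x; apply/cvgrPdist_le => e e0.
near=> y.
rewrite -dotBr (le_trans (dot_CauchySchwarz _ _))//.
(* The constant |h| + 1 can be divided by even when [h = 0]. *)
rewrite (@le_trans _ _ ((`|h| + 1) * `|x - y|))//.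
  by rewrite ler_wpM2r// lerDl.
rewrite -ler_pdivlMl ?ltr_pwDr// ltW//.
near: y; apply: cvgr_dist_lt => //.
by rewrite mulr_gt0// invr_gt0 ltr_pwDr.
Unshelve. all: by end_near. Qed.

(** The slab of all y with |<h, y>| <= c is closed and convex and contains D and -D, hence also the
    closed convex hull [A1 D]. *)
Lemma A1_dot_le (D : set H) (h x : H) (c : R) :
  (forall g, D g -> `|dot h g| <= c) -> A1 D x -> `|dot h x| <= c.
Proof.
move=> Dc A1x; set C := [set y | `|dot h y| <= c].
have clC : closed C.
  apply: (@preimage_closed _ _ (fun y => `|dot h y|) [set r | r <= c]).
    move=> y _; apply: continuous_comp; first exact: dot_continuous.
    exact: norm_continuous.
  exact: closed_le.
suff sub : convex_hull (symmetrization D) `<=` C.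
  by move/closureS: sub => /(_ _ A1x); rewrite -(proj1 (closure_id C) clC).
apply: smallest_sub.
  apply/convex_setW => y z; rewrite !inE /C /= => Cy Cz l l0 l1.
  apply/mem_set; change (is_true (`|dot h (l%:num *: (y : H) + (1 - l%:num) *: (z : H))| <= c)).
  rewrite dotDr !dotZr (le_trans (ler_normD _ _))// !normrM.
  rewrite (ger0_norm (ltW l0)) (@ger0_norm _ (1 - _)) ?subr_ge0 ?(ltW l1)//.
  have -> : c = l%:num * c + (1 - l%:num) * c by rewrite -mulrDl addrC subrK mul1r.
  by apply: lerD; apply: ler_wpM2l; rewrite // ?subr_ge0 ltW.
by move=> _ [/Dc//|[g /Dc + <-]]; rewrite /C/= -scaleN1r dotZr mulN1r normrN.
Qed.

End RealInnerProduct.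

(** * Residuals of the weak greedy algorithm *)

Section WeakGreedyAlgorithm.
Context {R : realType} {H : completeNormedModType R} {dot : {dot H for idfun}}.
Hypothesis dot_norm : forall x : H, `|x| = Num.sqrt (dot x x).
Context {D : set H} {t : nat -> R} {f : H} {phi : nat -> H}.
Hypothesis D1 : forall g, D g -> `|g| = 1.
Hypothesis phi_wga : wga_realization dot D t f phi.

Local Notation f_ := (wga_residual dot f phi).
Local Notation y_ k := `|dot (f_ k) (phi k.+1)|.
Local Notation dsup h := (sup [set `|dot h g| | g in D]).

Lemma residualE n : f_ n = f - wga_approx dot f phi n.
Proof.
elim: n => [|n IHn]; first by rewrite /wga_approx big_nil subr0.
by rewrite /wga_approx big_nat_recr//= -/(wga_approx dot f phi n) opprD addrA -IHn.
Qed.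

Lemma dot_le_sup h g : D g -> `|dot h g| <= dsup h.
Proof.
move=> Dg; apply: ub_le_sup; last by exists g.
exists `|h| => _ [k Dk <-].
by rewrite (le_trans (dot_CauchySchwarz dot_norm _ _))// (D1 Dk) mulr1.
Qed.

Lemma phi_in n : D (phi n.+1).
Proof. by have [] := phi_wga (ltn0Sn n). Qed.

Lemma greedy_step n : t n.+1 * dsup (f_ n) <= y_ n.
Proof. by have [] := phi_wga (ltn0Sn n). Qed.

Lemma sqr_norm_step n : `|f_ n.+1| ^+ 2 = `|f_ n| ^+ 2 - y_ n ^+ 2.
Proof. by rewrite /= sqr_norm_residual// D1//; exact: phi_in. Qed.

(** * Estimates for a fixed admissible [M] *)

Section A1Bound.
Context {M : R}.
Hypothesis M0 : 0 < M.
Hypothesis fM : A1 D (M^-1 *: f).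

Let b n : R := M + \sum_(j < n) y_ j.

Let bS n : b n.+1 = b n + y_ n.
Proof. by rewrite /b big_ord_recr/= addrA. Qed.

Let b_gt0 n : 0 < b n.
Proof. by rewrite ltr_pwDl// sumr_ge0. Qed.

(* Dual form of [A1norm D (f_ n) <= b n], which avoids showing that the gauge of
   [A1 D] is subadditive and attained. *)
Let dot_residual_le n h : `|dot h (f_ n)| <= b n * dsup h.
Proof.
elim: n => [|n IHn].
  rewrite /b big_ord0 addr0 -ler_pdivrMl//.
  rewrite -[M^-1 in X in X <= _]gtr0_norm ?invr_gt0// -normrM -dotZr.
  by apply: A1_dot_le fM => // g; exact: dot_le_sup.
rewrite bS mulrDl /= dotBr dotZr (le_trans (ler_normB _ _))// lerD//.
by rewrite normrM ler_wpM2l//; apply: dot_le_sup; exact: phi_in.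
Qed.

Let sqr_norm_le n : 0 <= t n.+1 -> t n.+1 * `|f_ n| ^+ 2 <= b n * y_ n.
Proof.
move=> t0; have := dot_residual_le n (f_ n).
rewrite -sqr_norm_dot// ger0_norm ?sqr_ge0// => fb.
rewrite (le_trans (ler_wpM2l t0 fb))// mulrCA.
by rewrite ler_wpM2l ?(ltW (b_gt0 n))// greedy_step.
Qed.

(** Duality at [h = f] gives |f|^2 <= M sup_g |<f, g>| <= M |f|. This starts the induction in
    [residual_growth]. *)
Lemma norm_le_A1 : `|f| <= M.
Proof.
have := dot_residual_le 0 f; rewrite -sqr_norm_dot// ger0_norm ?sqr_ge0//.
rewrite /b big_ord0 addr0 => fM2.
have [->|f0] := eqVneq f 0; first by rewrite normr0 ltW.
rewrite -(@ler_pM2r _ `|f|) ?normr_gt0// -expr2 (le_trans fM2)//.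
rewrite ler_pM2l//; apply: ge_sup => [|_ [g Dg <-]].
  by exists `|dot f (phi 1)|; exists (phi 1) => //; exact: phi_in.
by rewrite (le_trans (dot_CauchySchwarz dot_norm _ _))// (D1 Dg) mulr1.
Qed.

Lemma residual_growth n : (forall k, (1 <= k <= n)%N -> 0 <= t k <= 1) ->
  `|f_ n| ^+ 2 * (1 + \sum_(1 <= k < n.+1) t k ^+ 2) <= b n ^+ 2.
Proof.
elim: n => [|n IHn] t01.
  rewrite /b big_nil big_ord0 !addr0 mulr1 lerXn2r ?nnegrE ?norm_le_A1//.
  exact: ltW.
have {}IHn : `|f_ n| ^+ 2 * (1 + \sum_(1 <= k < n.+1) t k ^+ 2) <= b n ^+ 2.
  by apply: IHn => k /andP[k1 kn]; rewrite t01// k1 ltnW.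
have /andP[t0 t1] := t01 n.+1 (leqnn _).
rewrite big_nat_recr//= sqr_norm_step bS.
have := sqr_norm_le t0; have := b_gt0 n; have : 0 <= y_ n by [].
have : 0 <= \sum_(1 <= k < n.+1) t k ^+ 2 by apply: sumr_ge0 => k _; exact: sqr_ge0.
have := sqr_ge0 `|f_ n|.
move: IHn; move: (\sum_(1 <= k < n.+1) _) (`|f_ n| ^+ 2) (y_ n) (b n) (t n.+1) t0 t1.
move=> S a y c u u0 u1 aS a0 S0 y0 c0 uy.
(* Since [u <= 1], (a - y^2)(1 + S + u^2) <= c^2 + u a <= c^2 + c y <= (c + y)^2. *)
have : u ^+ 2 * a <= u * a by rewrite ler_wpM2r// expr2 ler_piMl.
have : 0 <= y ^+ 2 * (1 + (S + u ^+ 2)) by rewrite mulr_ge0 ?sqr_ge0// !addr_ge0 ?sqr_ge0.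
have : 0 <= c * y by rewrite mulr_ge0// ltW.
nra.
Qed.

(* One step multiplies the squared norm by at most [1 - s x <= exp (- s x)] and
   [b n] by [1 + x <= exp x], where [x = y_n / b n] and
   [s = 2 * alpha / (1 - alpha) <= t (n + 1)]. *)
Lemma residual_decay n (alpha : R) : 0 <= alpha < 1 ->
  (forall k, (1 <= k <= n)%N -> 2 * alpha <= (1 - alpha) * t k) ->
  `|f_ n| `^ (1 - alpha) * b n `^ alpha <= `|f| `^ (1 - alpha) * M `^ alpha.
Proof.
move=> /andP[al0 al1]; elim: n => [|n IHn] alt.
  by rewrite /b big_ord0 addr0.
apply: le_trans (IHn _); last first.
  by move=> k /andP[k1 kn]; rewrite alt// k1 ltnW.
have be0 : 0 < 1 - alpha by rewrite subr_gt0.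
set s := 2 * alpha / (1 - alpha); set x := y_ n / b n.
have st : s <= t n.+1 by rewrite ler_pdivrMr// [leRHS]mulrC alt//= leqnn.
have s0 : 0 <= s by rewrite divr_ge0// ?mulr_ge0// ltW.
have x0 : 0 <= x by rewrite divr_ge0// ltW.
have yE : y_ n = x * b n by rewrite divfK ?gt_eqF.
have fS : `|f_ n.+1| ^+ 2 <= `|f_ n| ^+ 2 * expR (- (s * x)).
  rewrite (@le_trans _ _ (`|f_ n| ^+ 2 * (1 - s * x)))//; last first.
    by rewrite ler_wpM2l ?sqr_ge0// expR_ge1Dx.
  rewrite sqr_norm_step mulrBr mulr1 lerD2l lerN2.
  (* s x |f_n|^2 <= x t_(n+1) |f_n|^2 <= x b_n y_n = y_n^2. *)
  have tf := sqr_norm_le (le_trans s0 st).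
  have -> : y_ n ^+ 2 = x * (b n * y_ n) by rewrite mulrA -yE expr2.
  rewrite mulrA [leLHS]mulrC ler_wpM2l// (le_trans _ tf)//.
  by rewrite mulrC ler_wpM2r ?sqr_ge0.
have fS' : `|f_ n.+1| `^ (1 - alpha) <= `|f_ n| `^ (1 - alpha) * expR (- (alpha * x)).
  have E (a : R) : 0 <= a -> a `^ (1 - alpha) = (a ^+ 2) `^ ((1 - alpha) / 2).
    by move=> a0; rewrite -powR_mulrn// -powRrM mulrCA divff// mulr1.
  (* The choice of [s] makes s (1 - alpha) / 2 equal to [alpha], so this factor cancels the growth
     factor of [b] in [bS']. *)
  rewrite !E// (_ : expR _ = expR (- (s * x)) `^ ((1 - alpha) / 2)); last first.
    by rewrite -expRM; congr expR; rewrite /s; field; rewrite gt_eqF.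
  rewrite -powRM ?sqr_ge0 ?expR_ge0// ge0_ler_powR ?nnegrE ?sqr_ge0//.
  by rewrite divr_ge0// ltW.
have bS' : b n.+1 `^ alpha <= b n `^ alpha * expR (alpha * x).
  rewrite (mulrC alpha) expRM -powRM ?expR_ge0 ?(ltW (b_gt0 n))//.
  rewrite ge0_ler_powR ?nnegrE ?mulr_ge0 ?expR_ge0 ?(ltW (b_gt0 _))//.
  have -> : b n.+1 = b n * (1 + x) by rewrite bS yE; ring.
  by rewrite ler_pM2l ?b_gt0// expR_ge1Dx.
apply: le_trans (ler_pM _ _ fS' bS') _; rewrite ?powR_ge0//.
by rewrite mulrACA -expRD addNr expR0 mulr1.
Qed.

(** Split |f_n| as |f_n|^(1 - alpha) |f_n|^alpha. The power alpha / 2 of [residual_growth] replaces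
    S^(alpha / 2) |f_n|^alpha by b_n^alpha, and [residual_decay] bounds the product. *)
Lemma residual_bound n (alpha : R) : 0 <= alpha < 1 ->
  (forall k, (1 <= k <= n)%N -> 0 <= t k <= 1) ->
  (forall k, (1 <= k <= n)%N -> 2 * alpha <= (1 - alpha) * t k) ->
  `|f_ n| <= (1 + \sum_(1 <= k < n.+1) t k ^+ 2) `^ (- alpha / 2)
     * `|f| `^ (1 - alpha) * M `^ alpha.
Proof.
move=> al t01 alt; set S := 1 + _.
have S0 : 0 < S by rewrite ltr_pwDl// sumr_ge0// => k _; exact: sqr_ge0.
have /andP[al0 al1] := al.
have [->|fn0] := eqVneq (f_ n) 0; first by rewrite normr0 !mulr_ge0 ?powR_ge0.
rewrite mulNr powRN -mulrA ler_pdivlMl ?powR_gt0//.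
apply: le_trans (residual_decay al alt).
rewrite [X in _ * X <= _](_ : _ = `|f_ n| `^ (1 - alpha) * `|f_ n| `^ alpha); last first.
  rewrite -powRD ?subrK ?powRr1//.
  by apply/implyP => _; rewrite normr_eq0.
rewrite mulrCA ler_wpM2l ?powR_ge0//.
rewrite (mulrC alpha) powRrM powR12_sqrt ?(ltW S0)// -powRM ?sqrtr_ge0//.
rewrite ge0_ler_powR ?nnegrE ?mulr_ge0 ?sqrtr_ge0 ?(ltW (b_gt0 n))//.
rewrite -(@ler_pXn2r _ 2) ?nnegrE ?mulr_ge0 ?sqrtr_ge0 ?(ltW (b_gt0 n))//.
by rewrite exprMn sqr_sqrtr ?(ltW S0)// mulrC residual_growth.
Qed.

End A1Bound.

Lemma norm_residual_le n : `|f_ n| <= `|f|.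
Proof.
elim: n => // n; apply: le_trans.
by rewrite -(@ler_pXn2r _ 2) ?nnegrE// sqr_norm_step gerBl sqr_ge0.
Qed.

End WeakGreedyAlgorithm.

(** Solving for M shows that (r / c)^(1 / alpha) is a lower bound of all admissible M, hence of
    their infimum, even when that is [+oo]; raising to the power [alpha] is monotone. *)
Lemma le_mule_A1norm_powR (R : realType) (H : completeNormedModType R)
    (D : set H) (f : H) (alpha c r : R) : 0 < alpha -> 0 < c -> 0 <= r ->
  (forall M, 0 < M -> A1 D (M^-1 *: f) -> r <= c * M `^ alpha) ->
  (r%:E <= c%:E * A1norm D f `^ alpha)%E.
Proof.
move=> al0 c0 r0 rM; rewrite -lee_pdivrMl// -EFinM mulrC.
have rc0 : 0 <= r / c by rewrite divr_ge0// ltW.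
have -> : r / c = ((r / c) `^ alpha^-1) `^ alpha.
  by rewrite -powRrM mulVf ?gt_eqF// powRr1.
have K : (((r / c) `^ alpha^-1)%:E <= A1norm D f)%E.
  apply: le_ereal_inf_tmp => _ [M [M0 fM] <-]; rewrite lee_fin.
  rewrite -[leRHS](powRr1 (ltW M0)) -[in leRHS](@mulfV _ alpha) ?gt_eqF// powRrM.
  rewrite ge0_ler_powR ?nnegrE ?powR_ge0 ?invr_ge0 ?(ltW al0)//.
  by rewrite ler_pdivrMr// mulrC rM.
rewrite -poweR_EFin gt0_ler_poweR ?(ltW al0)//.
  by rewrite in_itv/= lee_fin powR_ge0 leey.
by rewrite in_itv/= leey andbT (le_trans _ K)// lee_fin powR_ge0.
Qed.

Theorem theorem1p1 (R : realType) (H : completeNormedModType R)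
    (dot : {dot H for idfun})
    (dot_norm : forall x : H, `|x| = Num.sqrt (dot x x))
    (D : set H) (D_dict : is_dictionary D)
    (t : nat -> R)
    (t01 : forall k : nat, (1 <= k)%N -> 0 <= t k <= 1)
    (t_noninc : forall j k : nat, (1 <= j)%N -> (j <= k)%N -> t k <= t j)
    (m : nat) (m_ge1 : (1 <= m)%N)
    (alpha : R) (alpha_bnd : 0 <= alpha <= t m / (t m + 2))
    (f : H) (phi : nat -> H) (phi_wga : wga_realization dot D t f phi) :
  ((`|f - wga_approx dot f phi m|)%:E <=
     ((1 + \sum_(1 <= k < m.+1) t k ^+ 2) `^ (- alpha / 2))%:E
     * (`|f| `^ (1 - alpha))%:E
     * (A1norm D f `^ alpha))%E.
Proof.
have [D1 _] := D_dict; have /andP[al0 al_le] := alpha_bnd.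
rewrite -residualE.
have fm_le := norm_residual_le dot_norm D1 phi_wga m.
(* For [f = 0] the constant multiplying the power of [A1norm] would not be positive. *)
have [f0|f0] := eqVneq f 0.
  rewrite (@le_trans _ _ 0%E)// ?mule_ge0 ?poweR_ge0 ?lee_fin ?powR_ge0//.
  by rewrite (le_trans fm_le)// f0 normr0.
(* For [alpha = 0] the last factor is 1 even if [A1norm D f] is [+oo], and the claim is |f_m| <=
   |f|. *)
have [a0|al_neq0] := eqVneq alpha 0.
  by rewrite a0 oppr0 mul0r powRr0 poweRe0 mule1 mul1e addr0 powRr1// lee_fin.
have /andP[tm0 tm1] := t01 m m_ge1.
(* The bound on [alpha] with its denominator cleared; as [t] is nonincreasing, it passes to every
   [t k] with [k <= m]. *)
have al_tm : 2 * alpha <= (1 - alpha) * t m.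
  by move: al_le; rewrite ler_pdivlMr; nra.
have al1 : alpha < 1 by nra.
have S0 : 0 < 1 + \sum_(1 <= k < m.+1) t k ^+ 2.
  by rewrite ltr_pwDl// sumr_ge0// => k _; exact: sqr_ge0.
rewrite -EFinM; apply: le_mule_A1norm_powR => //.
- by rewrite lt_def al_neq0.
- by rewrite mulr_gt0// powR_gt0// normr_gt0.
move=> M M0 fM; apply: (residual_bound dot_norm D1 phi_wga M0 fM).
- by rewrite al0.
- by move=> k /andP[k1 _]; exact: t01.
move=> k /andP[k1 km]; rewrite (le_trans al_tm)// ler_wpM2l ?t_noninc//.
by rewrite subr_ge0 ltW.
Qed.
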